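(* Let $\mathbf A=\alpha\mathbf I+\mathbf S\in\mathbb R^{n\times n}$ with $\alpha\in\mathbb R$, $\alpha\neq 0$, $\mathbf S^\top=-\mathbf S$, and let $\mathbf b\in\mathbb R^n$ be nonzero. Let $\ell=\max_k\dim\mathcal K_k(\mathbf S,\mathbf b)$ and $\ell_0=\lceil\ell/2\rceil$. Let $\mathbf x_k^{\rm M}$ and $\mathbf x_k^{\rm LSQR}$ be the $k$th iterates of S$^3$MR and LSQR for $\mathbf A\mathbf x=\mathbf b$, respectively. For each $k$ with $1\leq k\leq \ell_0-1$, it holds that $$\|\mathbf b-\mathbf A\mathbf x_{2k}^{\rm M}\|_2\leq\|\mathbf b-\mathbf A\mathbf x_k^{\rm LSQR}\|_2.$$ Moreover, $\mathbf x_\ell^{\rm M}=\mathbf x_{\ell_0}^{\rm LSQR}=\mathbf A^{-1}\mathbf b$.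
   Context: Exact arithmetic and zero initial approximation are assumed. $\mathcal K_k(\mathbf M,\mathbf c)=\mathrm{span}\{\mathbf c,\mathbf M\mathbf c,\dots,\mathbf M^{k-1}\mathbf c\}$. The integer $\ell$ is the number of steps after which Lanczos tridiagonalization applied to $\mathbf S$ and $\mathbf b$ stops. The S$^3$MR iterate is $\mathbf x_k^{\rm M}=\mathrm{argmin}_{\mathbf x\in\mathcal K_k(\mathbf A,\mathbf b)}\|\mathbf b-\mathbf A\mathbf x\|_2$. The LSQR iterate is $\mathbf x_k^{\rm LSQR}=\mathrm{argmin}_{\mathbf x\in\mathcal K_k(\mathbf A^\top\mathbf A,\mathbf A^\top\mathbf b)}\|\mathbf b-\mathbf A\mathbf x\|_2$. (Minimizers are unique since $\mathbf A$ is nonsingular.) *)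

(* Defs.v *)
From HB Require Import structures.
From mathcomp Require Import all_boot all_order all_algebra.
From mathcomp Require Import boolp classical_sets reals.

Set Implicit Arguments.
Unset Strict Implicit.
Unset Printing Implicit Defensive.

Import Order.TTheory GRing.Theory Num.Theory.
Local Open Scope ring_scope.

Definition norm2 (R : realType) (n : nat) (v : 'cV[R]_n) : R :=
  Num.sqrt (\sum_(i < n) v i 0 ^+ 2).

Definition krylov (R : realType) (n : nat) (M : 'M[R]_n) (c : 'cV[R]_n)
    (k : nat) : {vspace 'cV[R]_n} :=
  <<[seq M ^+ i *m c | i <- iota 0 k]>>%VS.

Definition is_krylov_dim (R : realType) (n : nat) (M : 'M[R]_n)
    (c : 'cV[R]_n) : pred nat :=
  fun d => `[< exists k : nat, \dim (krylov M c k) = d >].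

Lemma krylov_dim_ex (R : realType) (n : nat) (M : 'M[R]_n) (c : 'cV[R]_n) :
  exists d, is_krylov_dim M c d.
Proof. by exists (\dim (krylov M c 0)); apply/asboolP; exists 0%N. Qed.

Lemma krylov_dim_le (R : realType) (n : nat) (M : 'M[R]_n) (c : 'cV[R]_n)
    (d : nat) :
  is_krylov_dim M c d -> (d <= n)%N.
Proof.
move=> /asboolP[k <-]; apply: leq_trans (dimvS (subvf _)) _.
by rewrite dimvf /dim /= muln1.
Qed.

(* max over all k : nat of \dim (krylov M c k) *)
Definition max_krylov_dim (R : realType) (n : nat) (M : 'M[R]_n)
    (c : 'cV[R]_n) : nat :=
  ex_maxn (krylov_dim_ex M c) (@krylov_dim_le R n M c).

(* The value is 0 if the residual norm has no minimizer on K; if the minimizer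
   is not unique, an unspecified one is returned. *)
Definition argmin_residual (R : realType) (n : nat) (A : 'M[R]_n)
    (b : 'cV[R]_n) (K : {vspace 'cV[R]_n}) : 'cV[R]_n :=
  xget 0 [set x : 'cV[R]_n | x \in K /\
    forall y, y \in K -> norm2 (b - A *m x) <= norm2 (b - A *m y)]%classic.

Definition s3mr (R : realType) (n : nat) (A : 'M[R]_n) (b : 'cV[R]_n)
    (k : nat) : 'cV[R]_n :=
  argmin_residual A b (krylov A b k).

Definition lsqr (R : realType) (n : nat) (A : 'M[R]_n) (b : 'cV[R]_n)
    (k : nat) : 'cV[R]_n :=
  argmin_residual A b (krylov (A^T *m A) (A^T *m b) k).

(* Main.v *)
Require Import Defs.
From mathcomp Require Import all_boot all_order all_algebra.
From mathcomp Require Import boolp classical_sets reals.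
Import Order.TTheory GRing.Theory Num.Theory.
Local Open Scope ring_scope.

(** Both iterates minimize the same residual, so the first claim follows from
    an inclusion of search spaces. Since [S] is skew, [A^T = alpha - S] and
    [A^T A = alpha^2 - S^2]; hence [(A^T A)^i A^T b], of degree [2 i + 1] in
    [S], lies in [K_(2 k)(S, b)] when [i < k], and this space is
    [K_(2 k)(A, b)] because a shift does not change Krylov spaces
    ([krylov_shift]). Residual minimizers over a subspace exist because the
    normal equations are consistent ([lstsq_ex]).

    For the second claim it suffices that both search spaces contain
    [A^-1 b]. The maximal dimension [l] is the index at which the Krylov
    sequence stagnates, [S^l b \in K_l(S, b)] ([max_krylov_dim_stagnate]). As
    [S] is skew, the vectors [S^(2 i) b] are orthogonal to the vectors
    [S^(2 j + 1) b] ([skew_even_odd_orth]); so in the expression of [S^l b] by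
    lower powers only those of the parity of [l] contribute, and with [m] the
    upper half of [l] the space [K_m(S^2, b)] is invariant under [S^2]
    ([skew_sqr_stagnate]). It is then invariant under the invertible matrix
    [A^T A], hence under its inverse. Therefore
    [A^-1 b = A^T (A^T A)^-1 b] lies in
    [A^T K_m(A^T A, b) = K_m(A^T A, A^T b)], the search space of LSQR, which
    is included in [K_(2 m)(S, b)] and thus, by stagnation, in [K_l(A, b)]. *)

Set Implicit Arguments.
Unset Strict Implicit.
Unset Printing Implicit Defensive.

(** * Euclidean geometry of column vectors *)

Section Euclid.
Context {R : realType}.

Lemma norm2E (n : nat) (v : 'cV[R]_n) : norm2 v = Num.sqrt ((v^T *m v) 0 0).
Proof. by rewrite /norm2 mxE; congr Num.sqrt; apply: eq_bigr => i _; rewrite mxE expr2. Qed.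

Lemma dotmx_ge0 (n : nat) (v : 'cV[R]_n) : 0 <= (v^T *m v) 0 0.
Proof. by rewrite mxE; apply: sumr_ge0 => i _; rewrite mxE -expr2 sqr_ge0. Qed.

Lemma dotmx_eq0 (n : nat) (v : 'cV[R]_n) : (v^T *m v) 0 0 = 0 -> v = 0.
Proof.
rewrite mxE => /eqP; rewrite psumr_eq0; last by move=> i _; rewrite mxE -expr2 sqr_ge0.
move=> /allP v0; apply/matrixP => i j; rewrite ord1 [RHS]mxE.
by move: (v0 i (mem_index_enum i)); rewrite mxE -expr2 sqrf_eq0 => /eqP.
Qed.

Lemma norm2_le0 (n : nat) (v : 'cV[R]_n) : norm2 v <= 0 -> v = 0.
Proof.
rewrite norm2E => v0; apply/dotmx_eq0/eqP; rewrite eq_le dotmx_ge0 andbT.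
by rewrite -sqrtr_eq0 eq_le v0 sqrtr_ge0.
Qed.

Lemma norm2_0 (n : nat) : norm2 (0 : 'cV[R]_n) = 0.
Proof. by rewrite norm2E mulmx0 mxE sqrtr0. Qed.

Lemma dotmxC (n : nat) (u v : 'cV[R]_n) : u^T *m v = v^T *m u.
Proof.
apply/matrixP => i j; rewrite !ord1 !mxE; apply: eq_bigr => k _.
by rewrite !mxE mulrC.
Qed.

(** One half of Pythagoras: adding an orthogonal vector does not shorten. *)
Lemma norm2_orth_le (n : nat) (r z : 'cV[R]_n) :
  r^T *m z = 0 -> norm2 r <= norm2 (r + z).
Proof.
move=> rz0; rewrite !norm2E ler_sqrt ?dotmx_ge0 //.
rewrite [(_ + _)^T]linearD /= mulmxDl !mulmxDr rz0 (dotmxC z r) rz0 addr0 add0r [leRHS]mxE.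
by rewrite lerDl dotmx_ge0.
Qed.

(** The Gram matrix [M^T M] has the same row space as [M]: if [w M^T] is in the
    kernel of [M], then [w M^T] has norm zero. *)
Lemma gram_submx (n d : nat) (M : 'M[R]_(n, d)) : (M <= M^T *m M)%MS.
Proof.
have sub : (M^T *m M <= M)%MS by exact: submxMl.
have [_ /esym] := mxrank_leqif_eq sub.
suff -> : \rank (M^T *m M) == \rank M by case/andP.
rewrite -[X in _ == X]mxrank_tr; apply/eqP/mxrank_injP; apply/rowV0P => u.
rewrite sub_capmx => /andP[/submxP[w ->] /sub_kermxP wM].
apply: trmx_inj; rewrite trmx0; apply: dotmx_eq0.
by rewrite trmxK trmx_mul trmxK mulmxA wM mul0mx mxE.
Qed.

(** The normal equations [M^T M z = M^T b], with the columns of [M] spanning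
    the image of the search space under [A], are consistent by [gram_submx]. *)
Lemma lstsq_ex (n : nat) (A : 'M[R]_n) (b : 'cV[R]_n) (V : {vspace 'cV[R]_n}) :
  exists x, x \in V /\
    forall y, y \in V -> norm2 (b - A *m x) <= norm2 (b - A *m y).
Proof.
pose B : 'M[R]_(n, \dim V) := \matrix_(i, j) ((vbasis V)`_j) i 0.
have BV w : B *m w \in V.
  have -> : B *m w = \sum_j w j 0 *: (vbasis V)`_j.
    apply/matrixP => i j; rewrite ord1 mxE summxE; apply: eq_bigr => k _.
    by rewrite !mxE mulrC.
  apply: memv_suml => j _; apply: memvZ; apply: vbasis_mem.
  by rewrite mem_nth // size_tuple.
have VB y : y \in V -> exists w, y = B *m w.
  move=> /coord_vbasis yE; exists (\col_j coord (vbasis V) j y).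
  rewrite {1}yE; apply/matrixP => i j; rewrite ord1 mxE summxE.
  by apply: eq_bigr => k _; rewrite !mxE mulrC.
pose M := A *m B.
have /submxP[w wE] : (b^T *m M <= M^T *m M)%MS.
  exact: submx_trans (submxMl _ _) (gram_submx _).
exists (B *m w^T); split=> // _ /VB[z ->].
have -> : b - A *m (B *m z) = b - A *m (B *m w^T) + M *m (w^T - z).
  by rewrite mulmxBr !mulmxA -/M addrA subrK.
apply: norm2_orth_le; rewrite mulmxA; set c := w^T - z.
have -> : A *m (B *m w^T) = (w *m M^T)^T by rewrite trmx_mul trmxK mulmxA.
by rewrite [(_ - _)^T]linearB /= trmxK mulmxBl wE mulmxA subrr mul0mx.
Qed.

Lemma argmin_residualP (n : nat) (A : 'M[R]_n) (b : 'cV[R]_n)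
    (V : {vspace 'cV[R]_n}) :
  argmin_residual A b V \in V /\ forall y, y \in V ->
    norm2 (b - A *m argmin_residual A b V) <= norm2 (b - A *m y).
Proof.
have := lstsq_ex A b V; rewrite /argmin_residual => ex.
exact: (xgetPex 0 ex).
Qed.

(** A larger search space gives a smaller residual. *)
Lemma argmin_residual_mono (n : nat) (A : 'M[R]_n) (b : 'cV[R]_n)
    (V W : {vspace 'cV[R]_n}) : (W <= V)%VS ->
  norm2 (b - A *m argmin_residual A b V) <=
  norm2 (b - A *m argmin_residual A b W).
Proof.
move=> /subvP WV; have [_ minV] := argmin_residualP A b V.
by have [inW _] := argmin_residualP A b W; apply: minV; apply: WV.
Qed.

Lemma argmin_residual_exact (n : nat) (A : 'M[R]_n) (b : 'cV[R]_n)
    (V : {vspace 'cV[R]_n}) : A \in unitmx -> invmx A *m b \in V ->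
  argmin_residual A b V = invmx A *m b.
Proof.
move=> Au inV; have [_ /(_ _ inV)] := argmin_residualP A b V.
rewrite mulKVmx // subrr norm2_0 => /norm2_le0/eqP; rewrite subr_eq0 => /eqP bE.
by rewrite [in RHS]bE mulKmx.
Qed.

(** By dimension, an invertible matrix maps an invariant subspace onto itself. *)
Lemma invmx_invariant (n : nat) (H : 'M[R]_n) (V : {vspace 'cV[R]_n}) :
  H \in unitmx -> (forall x, x \in V -> H *m x \in V) ->
  forall x, x \in V -> invmx H *m x \in V.
Proof.
move=> Hu HV x xV; pose f := linfun (mulmx H : 'cV[R]_n -> 'cV[R]_n).
have fE y : f y = H *m y by rewrite lfunE.
have kf : lker f = 0%VS.
  apply/eqP/lker0P => y z; rewrite !fE => /(congr1 (mulmx (invmx H))).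
  by rewrite !mulKmx.
have : x \in (f @: V)%VS.
  suff -> : (f @: V)%VS = V by [].
  apply/eqP; rewrite eqEdim limg_dim_eq ?kf ?capv0 // leqnn andbT.
  by apply/subvP => _ /memv_imgP[y yV ->]; rewrite fE HV.
by move=> /memv_imgP[y yV ->]; rewrite fE mulKmx.
Qed.

End Euclid.

(** * Krylov spaces *)

Section Krylov.
Context {R : realType} {n : nat}.
Implicit Types (M N H S : 'M[R]_n) (c x y v : 'cV[R]_n) (V : {vspace 'cV[R]_n}).

Lemma mulexpS M i c : M ^+ i.+1 *m c = M *m (M ^+ i *m c).
Proof. by rewrite exprS -mulmxE mulmxA. Qed.

Lemma mulexpSr M i c : M ^+ i.+1 *m c = M ^+ i *m (M *m c).
Proof. by rewrite exprSr -mulmxE mulmxA. Qed.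

Lemma mulexp_double M i c : M ^+ i.*2 *m c = (M *m M) ^+ i *m c.
Proof. by rewrite -mul2n exprM expr2 mulmxE. Qed.

Lemma mem_krylov M c k i : (i < k)%N -> M ^+ i *m c \in krylov M c k.
Proof. by move=> ik; apply/memv_span/map_f; rewrite mem_iota. Qed.

Lemma krylov_subP M c k V :
  (forall i, (i < k)%N -> M ^+ i *m c \in V) -> (krylov M c k <= V)%VS.
Proof.
move=> KV; apply/span_subvP => _ /mapP[i + ->].
by rewrite mem_iota /= => /KV.
Qed.

Lemma krylovS M c k : krylov M c k.+1 = (krylov M c k + <[M ^+ k *m c]>)%VS.
Proof. by rewrite /krylov -(addn1 k) iotaD map_cat span_cat span_seq1. Qed.

Lemma krylov_mono M c j k : (j <= k)%N -> (krylov M c j <= krylov M c k)%VS.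
Proof. by move=> jk; apply: krylov_subP => i ij; apply/mem_krylov/(leq_trans ij). Qed.

(** A property closed under linear combinations holds on a Krylov space as
    soon as it holds on its generators. *)
Lemma krylov_ind M c k (P : 'cV[R]_n -> Prop) :
  P 0 -> (forall a x y, P x -> P y -> P (a *: x + y)) ->
  (forall i, (i < k)%N -> P (M ^+ i *m c)) ->
  forall x, x \in krylov M c k -> P x.
Proof.
move=> P0 PD; elim: k => [|k IHk] Pc x.
  by rewrite /krylov span_nil memv0 => /eqP ->.
rewrite krylovS => /memv_addP[u uK [_ /vlineP[a ->] ->]].
rewrite addrC; apply: PD; first exact: Pc.
by apply: IHk uK => i ik; apply: Pc; rewrite ltnS ltnW.
Qed.

Lemma krylov_mulP N M c k V : (forall i, (i < k)%N -> N *m (M ^+ i *m c) \in V) ->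
  forall x, x \in krylov M c k -> N *m x \in V.
Proof.
move=> NV; apply: krylov_ind => [|a x y xV yV|//]; first by rewrite mulmx0 mem0v.
by rewrite mulmxDr -scalemxAr memvD ?memvZ.
Qed.

Lemma krylov_mul M c k x : x \in krylov M c k -> M *m x \in krylov M c k.+1.
Proof. by move: x; apply: krylov_mulP => i ik; rewrite -mulexpS mem_krylov. Qed.

Lemma krylov_mul_shift a e M c k x :
  x \in krylov M c k -> (a%:M + e *: M) *m x \in krylov M c k.+1.
Proof.
move=> xK; rewrite mulmxDl mul_scalar_mx -scalemxAl memvD // memvZ //.
  by apply: (subvP (krylov_mono _ _ (leqnSn k))).
exact: krylov_mul.
Qed.

Lemma krylov_shift_sub a e M c k :
  (krylov (a%:M + e *: M) c k <= krylov M c k)%VS.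
Proof.
apply: krylov_subP => i ik; apply: (subvP (krylov_mono _ _ ik)).
elim: i {ik} => [|i IHi]; first exact: (mem_krylov M c (ltnSn 0)).
by rewrite mulexpS krylov_mul_shift.
Qed.

(** Krylov spaces only depend on the matrix up to shift and scaling. *)
Lemma krylov_shift a e M c k :
  e != 0 -> krylov (a%:M + e *: M) c k = krylov M c k.
Proof.
move=> e0; apply/eqP; rewrite eqEsubv krylov_shift_sub /=.
have {1}-> : M = (- (e^-1 * a))%:M + e^-1 *: (a%:M + e *: M).
  rewrite scalerDr scalerA mulVf // scale1r scale_scalar_mx addrA -raddfD /=.
  by rewrite addNr raddf0 add0r.
exact: krylov_shift_sub.
Qed.

Lemma krylov_comm N M c k x : M *m N = N *m M ->
  x \in krylov M c k -> N *m x \in krylov M (N *m c) k.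
Proof.
move=> MN; move: x; apply: krylov_mulP => i ik.
suff -> : N *m (M ^+ i *m c) = M ^+ i *m (N *m c) by rewrite mem_krylov.
elim: i {ik} => [|i IHi]; first by rewrite !expr0 !mul1mx.
by rewrite !mulexpS -IHi !mulmxA MN.
Qed.

Lemma krylov_invariant M c k : M ^+ k *m c \in krylov M c k ->
  forall x, x \in krylov M c k -> M *m x \in krylov M c k.
Proof.
move=> Mk; apply: krylov_mulP => i; rewrite -mulexpS leq_eqVlt => /orP[/eqP->//|].
exact: mem_krylov.
Qed.

Lemma krylov_stagnate M c j : M ^+ j *m c \in krylov M c j ->
  forall k, (krylov M c k <= krylov M c j)%VS.
Proof.
move=> Mj k; apply: krylov_subP => i _.
have [/mem_krylov//|ji] := ltnP i j.
rewrite -(subnK ji) addnC; elim: (i - j)%N => [|d IHd]; first by rewrite addn0.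
by rewrite addnS mulexpS krylov_invariant.
Qed.

(** The largest dimension is the index at which the Krylov sequence stops
    growing: before that index every step adds one dimension. *)
Lemma max_krylov_dim_stagnate M c (l := max_krylov_dim M c) :
  M ^+ l *m c \in krylov M c l.
Proof.
rewrite {}/l /max_krylov_dim; case: ex_maxnP => l _ lmax.
apply: contraT => nin.
(* a stagnation before step l would put M^l c in K_l *)
have nin' i : (i <= l)%N -> M ^+ i *m c \notin krylov M c i.
  move=> il; apply: contra nin => /krylov_stagnate/(_ l.+1)/subvP sub.
  apply: (subvP (krylov_mono _ _ il)); apply: sub; exact: mem_krylov.
have dimK i : (i <= l.+1)%N -> \dim (krylov M c i) = i.
  elim: i => [|i IHi] il; first by rewrite /krylov span_nil dimv0.
  have Mi := nin' i il.
  have Mi0 : M ^+ i *m c != 0 by apply: contraNneq Mi => ->; rewrite mem0v.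
  rewrite krylovS dimv_disjoint_sum; first by rewrite IHi ?dim_vline ?Mi0 ?addn1 // ltnW.
  apply/eqP; rewrite -subv0; apply/subvP => x; rewrite memv_cap => /andP[xK].
  move=> /vlineP[a xE]; have [a0|a0] := eqVneq a 0.
    by rewrite xE a0 scale0r mem0v.
  case/negP: Mi; rewrite -[_ *m c]scale1r -(mulVf a0) -scalerA -xE memvZ //.
suff /lmax : is_krylov_dim M c l.+1 by rewrite ltnn.
by apply/asboolP; exists l.+1; rewrite dimK.
Qed.

(** The even and odd powers span two Krylov spaces of the square. *)
Lemma krylov_even_odd M c k : (krylov M c k <=
  krylov (M *m M) c (uphalf k) + krylov (M *m M) (M *m c) k./2)%VS.
Proof.
apply: krylov_subP => i; rewrite -(odd_double_half i).
case: (odd i); rewrite ?add0n ?add1n => ik.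
  rewrite mulexpSr mulexp_double; apply: (subvP (addvSr _ _)); apply: mem_krylov.
  by rewrite geq_half_double doubleS.
rewrite mulexp_double; apply: (subvP (addvSl _ _)); apply: mem_krylov.
by rewrite uphalfE geq_half_double doubleS ltnS.
Qed.

End Krylov.

(** * Skew-symmetric matrices *)

Section Skew.
Context {R : realType} {n : nat} {S : 'M[R]_n} (S_skew : S^T = - S).
Implicit Types (b x y c : 'cV[R]_n).

Lemma skew_adj x y : (S *m x)^T *m y = - (x^T *m (S *m y)).
Proof. by rewrite trmx_mul S_skew mulmxN mulNmx mulmxA. Qed.

Lemma skew_dot0 x : x^T *m (S *m x) = 0.
Proof.
have := skew_adj x x; rewrite dotmxC => /eqP; rewrite -addr_eq0 => /eqP e.
apply/matrixP => i j; move/matrixP/(_ i j): e; rewrite [LHS]mxE [RHS]mxE -mulr2n => /eqP.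
by rewrite mulrn_eq0 => /eqP ->; rewrite [RHS]mxE.
Qed.

Lemma skew_sqr_adj x y : (S *m S *m x)^T *m y = x^T *m (S *m S *m y).
Proof. by rewrite -mulmxA !skew_adj opprK !mulmxA. Qed.

Lemma skew_even_odd_orth b k m u v : u \in krylov (S *m S) b k ->
  v \in krylov (S *m S) (S *m b) m -> u^T *m v = 0.
Proof.
move=> uE vO; move: u uE; apply: krylov_ind => [|a x y xv yv|i _].
- by rewrite trmx0 mul0mx.
- by rewrite [(_ + _)^T]linearD /= [(_ *: _)^T]linearZ /= mulmxDl -scalemxAl xv yv scaler0 addr0.
move: v vO; apply: krylov_ind => [|a x y xv yv|j _].
- by rewrite mulmx0.
- by rewrite mulmxDr -scalemxAr xv yv scaler0 addr0.
(* moving all even powers to the right leaves b^T S^(2 j + 1) b, which is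
   c^T S c, up to sign, for c = S^j b *)
elim: i j => [|i IHi] j; last first.
  by rewrite mulexpS skew_sqr_adj -mulexpS IHi.
rewrite expr0 mul1mx.
have -> : (S *m S) ^+ j *m (S *m b) = S ^+ j *m (S *m (S ^+ j *m b)).
  by rewrite -mulexpS mulexpSr -mulexp_double -addnn exprD -mulmxE !mulmxA.
have adj i x y : x^T *m (S ^+ i *m y) = (-1) ^+ i *: ((S ^+ i *m x)^T *m y).
  elim: i x y => [|i IHi] x y; first by rewrite !expr0 !mul1mx scale1r.
  by rewrite mulexpSr IHi [in RHS]mulexpS skew_adj exprS mulN1r scaleNr scalerN opprK.
by rewrite adj skew_dot0 scaler0.
Qed.

(** Stagnation of the Krylov sequence of [S] at [l] makes that of its square
    stagnate at [l / 2], rounded up: in the expression of [S^l b] by lower powers,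
    the component of the wrong parity vanishes, being orthogonal to the rest. *)
Lemma skew_sqr_stagnate b l (m := uphalf l) : S ^+ l *m b \in krylov S b l ->
  (S *m S) ^+ m *m b \in krylov (S *m S) b m.
Proof.
move=> Sl; have := subvP (krylov_even_odd S b l) _ Sl.
move=> /memv_addP[u uE [v vO SlE]].
have uv := skew_even_odd_orth uE vO.
rewrite {}/m; have lE := odd_double_half l; move: SlE uE vO; rewrite uphalf_half.
move: (odd l) l./2 lE => o h <-; case: o; rewrite ?add0n ?add1n => SlE uE vO.
  (* odd index: the even part u is orthogonal both to v and to the left-hand
     side u + v, so it vanishes; one more factor S gives the even power *)
  suff u0 : u = 0.
    rewrite u0 add0r in SlE; rewrite -mulexp_double doubleS mulexpS SlE.
    have : S *m v \in krylov (S *m S) (S *m (S *m b)) h.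
      by apply: krylov_comm vO; rewrite mulmxA.
    apply: subvP; apply: krylov_subP => i il.
    by rewrite [S *m (S *m b)]mulmxA -mulexpSr mem_krylov.
  have dot0 : u^T *m (S ^+ h.*2.+1 *m b) = 0.
    rewrite mulexpSr mulexp_double; apply: (skew_even_odd_orth uE).
    exact: (mem_krylov _ _ (ltnSn h)).
  by apply: dotmx_eq0; move: dot0; rewrite SlE mulmxDr uv addr0 => ->; rewrite mxE.
(* even index: likewise the odd part v vanishes *)
suff v0 : v = 0 by rewrite -mulexp_double SlE v0 addr0.
have dot0 : (S ^+ h.*2 *m b)^T *m v = 0.
  rewrite mulexp_double; apply: (skew_even_odd_orth _ vO).
  exact: mem_krylov.
by apply: dotmx_eq0; move: dot0; rewrite SlE [(_ + _)^T]linearD /= mulmxDl uv add0r => ->; rewrite mxE.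
Qed.

(** [u (alpha + S) u^T = alpha |u|^2], so the kernel of [alpha + S] is trivial. *)
Lemma skew_shift_unit (alpha : R) : alpha != 0 -> alpha%:M + S \in unitmx.
Proof.
move=> a0; rewrite -row_free_unit -kermx_eq0; apply/rowV0P => u /sub_kermxP uA.
apply: trmx_inj; rewrite trmx0; apply: dotmx_eq0.
have := congr1 (mulmx^~ u^T) uA; rewrite mul0mx mulmxDr mul_mx_scalar mulmxDl -scalemxAl.
rewrite -mulmxA; have := skew_dot0 u^T; rewrite trmxK => ->; rewrite addr0.
by move=> /matrixP/(_ 0 0); rewrite !mxE => /eqP; rewrite mulf_eq0 (negbTE a0) => /eqP.
Qed.

End Skew.

(** * Comparison of the two iterations *)

Unset Implicit Arguments.
Set Strict Implicit.
Set Printing Implicit Defensive.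

Theorem proposition8 (R : realType) (n : nat) (alpha : R) (S A : 'M[R]_n)
    (b : 'cV[R]_n) (ell ell0 : nat)
    (alpha_neq0 : alpha <> 0)
    (S_skew : S^T = - S)
    (A_def : A = alpha%:M + S)
    (b_neq0 : b <> 0)
    (ell_def : ell = max_krylov_dim S b)
    (ell0_def : ell0 = uphalf ell) :
  (forall k : nat, (1 <= k <= ell0 - 1)%N ->
     norm2 (b - A *m s3mr A b (2 * k)) <= norm2 (b - A *m lsqr A b k)) /\
  s3mr A b ell = lsqr A b ell0 /\
  lsqr A b ell0 = invmx A *m b.
Proof.
have a0 : alpha != 0 by apply/eqP.
have Au : A \in unitmx by rewrite A_def (skew_shift_unit S_skew).
have KA k : krylov A b k = krylov S b k.
  by rewrite A_def -[S in _ + S]scale1r krylov_shift ?oner_neq0.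
have ATE : A^T = alpha%:M + (-1) *: S.
  by rewrite A_def linearD /= tr_scalar_mx S_skew scaleN1r.
have ASE : A = alpha%:M + 1 *: S by rewrite scale1r.
have AAE : A^T *m A = (alpha ^+ 2)%:M + (-1) *: (S *m S).
  rewrite ATE A_def scaleN1r scaleN1r mulmxDl !mulmxDr mulNmx -scalar_mxM -expr2.
  by rewrite mulNmx scalar_mxC addrA -[_ - _ *m S]addrA -addrA; congr (_ + _); rewrite addrA subrr add0r.
(* (A^T A)^i A^T b has degree 2 i + 1 in S *)
have sub k : (krylov (A^T *m A) (A^T *m b) k <= krylov S b (2 * k))%VS.
  apply: krylov_subP => i ik.
  have i2 : (i.*2.+2 <= 2 * k)%N by rewrite mul2n -doubleS leq_double.
  apply: (subvP (krylov_mono _ _ i2)).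
  elim: i {ik i2} => [|i IHi].
    rewrite expr0 mul1mx ATE krylov_mul_shift //.
    by have := mem_krylov S b (ltnSn 0); rewrite expr0 mul1mx.
  by rewrite mulexpS -mulmxA doubleS {1}ATE {1}ASE !krylov_mul_shift.
have stag : S ^+ ell *m b \in krylov S b ell.
  by rewrite ell_def; exact: max_krylov_dim_stagnate.
have lsqr_in : invmx A *m b \in krylov (A^T *m A) (A^T *m b) ell0.
  have Hu : A^T *m A \in unitmx by rewrite unitmx_mul unitmx_tr Au.
  have comm : A *m A^T = A^T *m A.
    have -> : A^T = (alpha + alpha)%:M - A.
      by rewrite ATE A_def scaleN1r raddfD /= opprD addrACA subrr add0r.
    by rewrite mulmxBr mulmxBl scalar_mxC.
  (* A A^T = A^T A gives A^-1 = A^T (A^T A)^-1 *)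
  have -> : invmx A *m b = A^T *m (invmx (A^T *m A) *m b).
    by apply: (can_inj (mulKmx Au)); rewrite mulKVmx // mulmxA comm mulKVmx.
  apply: krylov_comm; first by rewrite -mulmxA comm mulmxA.
  have KH : krylov (A^T *m A) b ell0 = krylov (S *m S) b ell0.
    by rewrite AAE krylov_shift // oppr_eq0 oner_neq0.
  apply: invmx_invariant => // [x|]; rewrite KH.
    rewrite AAE mulmxDl mul_scalar_mx -scalemxAl => xK.
    apply: memvD; apply: memvZ => //; apply: krylov_invariant xK.
    by rewrite ell0_def; exact: skew_sqr_stagnate.
  (* b is a generator of the space since l > 0, because b <> 0 *)
  rewrite -[b in b \in _]mul1mx; apply: (mem_krylov (S *m S) b (i := 0)).
  rewrite ell0_def uphalf_gt0 lt0n; apply/eqP => ell_eq0; apply: b_neq0.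
  move: stag; rewrite ell_eq0 expr0 mul1mx /krylov span_nil memv0.
  by move=> /eqP.
have lsqrE : lsqr A b ell0 = invmx A *m b by exact: argmin_residual_exact.
split; last split=> //.
- move=> k _; apply: argmin_residual_mono; rewrite KA; exact: sub.
- rewrite lsqrE; apply: argmin_residual_exact => //; rewrite KA.
  exact: (subvP (subv_trans (sub ell0) (krylov_stagnate stag _))).
Qed.
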